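(* For every integer $v$ with $3\le v\le 16$ we have $g(v,3)\le 16$, and for every integer $v$ with $3\le v\le 32$ we have $g(v,3)\le 96$.
   Context: For integers $v\ge t\ge 2$, let $[v]=\{0,\dots,v-1\}$, let $\mathcal{S}_v$ be the set of permutations of $[v]$ (bijections $[v]\to[v]$), and let $\mathcal{S}_{v,t}$ be the set of ordered sequences of $t$ distinct elements of $[v]$. A sequence $s=(s_0,\dots,s_{t-1})\in\mathcal{S}_{v,t}$ is covered by $\pi\in\mathcal{S}_v$ if $\pi^{-1}(s_i)<\pi^{-1}(s_{i+1})$ for $0\le i\le t-2$. For a positive integer $\lambda$, a PSCA$(v,t,\lambda)$ is a multiset $X$ of permutations in $\mathcal{S}_v$ such that every sequence in $\mathcal{S}_{v,t}$ is covered by exactly $\lambda$ permutations in $X$ (counted with multiplicity). For $v\ge t\ge2$, $g(v,t)$ denotes the smallest positive integer $\lambda$ such that a PSCA$(v,t,\lambda)$ exists. *)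

(* Defs.v *)
From mathcomp Require Import all_boot all_fingroup.
From mathcomp Require Import finmap multiset boolp.
Set Implicit Arguments.
Unset Strict Implicit.
Unset Printing Implicit Defensive.

Local Open Scope mset_scope.

(* [p^-1 a] is the position of the symbol [a] in [p 0, p 1, ..., p v.-1];
   [sorted] compares adjacent entries of [s]. *)
Definition covers (v : nat) (p : 'S_v) (s : seq 'I_v) : bool :=
  sorted (fun a b : 'I_v => (p^-1)%g a < (p^-1)%g b) s.

(* [X p] is the multiplicity of [p] in the multiset [X]. *)
Definition is_PSCA (v t lambda : nat) (X : {mset 'S_v}) : Prop :=
  forall s : t.-tuple 'I_v, uniq s ->
    \sum_(p : 'S_v | covers p s) X p = lambda.

Definition PSCA_lambda (v t : nat) : pred nat :=
  fun lambda => (0 < lambda) && `[< exists X : {mset 'S_v}, is_PSCA t lambda X >].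

(* The multiset of all permutations is a PSCA when [t <= v]; when [v < t]
   there is no sequence to cover. *)
Lemma PSCA_lambda_ex (v t : nat) : exists lambda, PSCA_lambda v t lambda.
Proof.
have covM (p q : 'S_v) (s : seq 'I_v) :
    covers (p * q)%g (map q s) = covers p s.
  rewrite /covers sorted_map; apply: eq_sorted => a b /=.
  by rewrite invMg !permM !permK.
pose e := take t (enum 'I_v); pose N := #|[pred p : 'S_v | covers p e]|.
have N_gt0 : 0 < N.
  apply/card_gt0P; exists 1%g; rewrite inE /covers invg1.
  rewrite (eq_sorted (e' := relpre val ltn)); last by move=> a b /=; rewrite !perm1.
  by rewrite -sorted_map map_take val_enum_ord take_sorted // iota_ltn_sorted.
exists N; rewrite /PSCA_lambda N_gt0; apply/asboolP.
exists (seq_mset (enum {: 'S_v})) => s s_uniq.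
under eq_bigr => p _ do
  rewrite mset_seqE count_uniq_mem ?enum_uniq // mem_enum inE /=.
rewrite sum1_card.
pose L := s ++ [seq x <- enum 'I_v | x \notin (s : seq _)].
have L_uniq : uniq L.
  rewrite cat_uniq s_uniq filter_uniq ?enum_uniq // andbT.
  by apply/hasPn => x; rewrite mem_filter => /andP[].
have L_size : size L = v.
  rewrite -[RHS]card_ord cardE; apply: perm_size.
  apply: uniq_perm; rewrite ?enum_uniq // => x.
  by rewrite mem_cat mem_filter mem_enum inE andbT orbN.
have f_inj : injective (fun i : 'I_v => nth i L i).
  move=> i j /=; rewrite (set_nth_default i j) ?L_size // => /eqP.
  by rewrite nth_uniq ?L_size // => /eqP/val_inj.
have es : map (perm f_inj) e = s.
  have tv : t <= v by rewrite -[v]L_size size_cat size_tuple leq_addr.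
  have e_size : size e = t.
    by rewrite size_takel // size_enum_ord.
  have [v0 | v_gt0] := posnP v.
    have t0 : t = 0 by apply/eqP; rewrite -leqn0 -v0.
    rewrite (size0nil (etrans e_size t0)).
    by rewrite (size0nil (etrans (size_tuple s) t0)).
  pose x0 : 'I_v := Ordinal v_gt0.
  apply: (@eq_from_nth _ x0); rewrite size_map e_size ?size_tuple // => i it.
  have iv : i < v by apply: leq_trans tv.
  rewrite (nth_map x0) ?e_size // permE nth_take //.
  rewrite (_ : nth x0 (enum 'I_v) i = Ordinal iv); last first.
    by apply: val_inj; rewrite /= nth_enum_ord.
  by rewrite (set_nth_default x0) ?L_size // nth_cat size_tuple it.
rewrite -es /N -[RHS](card_imset _ (mulIg (perm f_inj))).
apply: eq_card => p; rewrite unfold_in /=; apply/idP/imsetP => [cp | [q cq ->]].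
  by exists (p * (perm f_inj)^-1)%g; rewrite ?mulgKV // inE -(covM _ (perm f_inj)) mulgKV.
by move: cq; rewrite inE -(covM _ (perm f_inj)).
Qed.

Definition g (v t : nat) : nat := ex_minn (PSCA_lambda_ex v t).

(* Main.v *)
Require Import Defs.
From mathcomp Require Import all_boot.
From mathcomp Require Import all_fingroup finmap multiset boolp.
Set Implicit Arguments.
Unset Strict Implicit.
Unset Printing Implicit Defensive.

Local Open Scope mset_scope.

(** Identify the symbols with vectors of F_2^n.  A basis f_1, ..., f_n of the
    dual space and a vector e of F_2^n order F_2^n lexicographically: x comes
    before y when, at the first i with f_i(x) <> f_i(y), one has f_i(x) = e_i.
    Call e the shift.

    Take distinct points x, y, z, put u = x + y and w = y + z, and let i and j
    be the indices of the first basis functionals that do not vanish on u and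
    on w.  If i = j then f_i isolates y from x and z, so y is never between
    them.  If i <> j then x, y, z appear in this order exactly when
    e_i = f_i(x) and e_j = f_j(y) ([count_before2]), which happens for one
    quarter of the shifts as soon as the shifts are pairwise uniform; eight
    shifts suffice for this ([shifts_uniform]).

    On the plane {0, u, w, u + w} the first functional that is not zero is
    nonzero on exactly two of u, w, u + w.  A family of bases that is fair on
    every such plane has i = j for one third of its members.  Every sequence
    of three symbols is then covered by 2/3 * 1/4 = 1/6 of all the orders,
    which is what a perfect array needs ([PSCA3_of_flags]).  Fewer than 2^n
    symbols are handled by restricting the orders to some of the vectors.

    A fair family of 12 bases exists for n = 4 and one of 72 bases for n = 5
    ([equilead_flags4], [equilead_flags5]).  Both are unions of orbits under
    a small linear group; fairness is a finite check on pairs of nonzero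
    vectors.  With the eight shifts they give 96 and 576 permutations, that is
    16 and 96 times 3!. *)

(** * Vectors over F_2 and linear functionals *)

Fixpoint cube (n : nat) : seq (seq bool) :=
  if n is n'.+1 then [seq b :: x | b <- [:: false; true], x <- cube n']
  else [:: [::]].

Lemma mem_cube n x : (x \in cube n) = (size x == n).
Proof.
elim: n x => [|n IHn] [|b x] //.
  by apply/allpairsP => -[[c y]] /= [].
rewrite eqSS -IHn; apply/allpairsP/idP => [[[c y] /= [_ ? [_ ->]]] //|x_n].
by exists (b, x); rewrite /= !inE x_n; case: b.
Qed.

(** The binary digits of [k], least significant first: this both places the
    symbols in F_2^n and abbreviates functionals by numbers. *)
Fixpoint bits (n k : nat) : seq bool :=
  if n is n'.+1 then odd k :: bits n' k./2 else [::].

Lemma size_bits n k : size (bits n k) = n.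
Proof. by elim: n k => //= n IHn k; rewrite IHn. Qed.

Lemma bits_inj n k l : k < 2 ^ n -> l < 2 ^ n -> bits n k = bits n l -> k = l.
Proof.
elim: n k l => [|n IHn] k l /=; first by rewrite expn0 !ltnS !leqn0 => /eqP-> /eqP->.
rewrite expnS mul2n => kn ln [odd_kl /IHn half_kl].
by rewrite -[k]odd_double_half -[l]odd_double_half odd_kl half_kl ?ltn_half_double.
Qed.

Definition addv (x y : seq bool) : seq bool := [seq p.1 (+) p.2 | p <- zip x y].

Lemma size_addv x y : size x = size y -> size (addv x y) = size x.
Proof. by move=> xy; rewrite size_map size1_zip ?xy. Qed.

Lemma has_addv x y : size x = size y -> has id (addv x y) = (x != y).
Proof.
elim: x y => [|b x IHx] [|c y] //= [/IHx {}IHx].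
by rewrite eqseq_cons negb_and -IHx negb_eqb.
Qed.

Lemma addvC x y : addv x y = addv y x.
Proof. by elim: x y => [|b x IHx] [|c y] //; rewrite /addv /= addbC -/(addv x y) IHx. Qed.

Lemma addv_inj x y z :
  size x = size y -> size z = size y -> addv x y = addv y z -> x = z.
Proof.
rewrite (addvC y z).
elim: x y z => [|b x IHx] [|c y] [|d z] // [xy] [zy] [/addIb-> xz].
by rewrite (IHx y z).
Qed.

Definition dot (f x : seq bool) : bool :=
  foldr (fun p b => (p.1 && p.2) (+) b) false (zip f x).

Lemma dot_addv f x y :
  size x = size y -> dot f (addv x y) = dot f x (+) dot f y.
Proof.
elim: f x y => [|a f IHf] [|b x] [|c y] //= [/IHf {}IHf].
by rewrite /dot /= -!/(dot _ _) IHf andb_addr addbACA.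
Qed.

(** * Lexicographic orders given by a basis and a shift *)

Definition lead (F : seq (seq bool)) (u : seq bool) : nat := find (dot^~ u) F.

(** The shift [e] names, for each functional, the value that comes first. *)
Fixpoint before (F : seq (seq bool)) (e x y : seq bool) : bool :=
  if F is f :: F' then
    if dot f x == dot f y then before F' (behead e) x y
    else dot f x == head false e
  else false.

Lemma before_irr F e : irreflexive (before F e).
Proof. by move=> x; elim: F e => //= f F IHF e; rewrite eqxx. Qed.

Lemma before_trans F e : transitive (before F e).
Proof.
move=> y x z; elim: F e => //= f F IHF e.
by case: (dot f x) (dot f y) (dot f z) (head _ e) => [] [] [] [] //=; apply: IHF.
Qed.

Lemma before_total F e x y :
  has (fun f => dot f x != dot f y) F -> before F e x y || before F e y x.
Proof.
elim: F e => //= f F IHF e; rewrite (eq_sym (dot f y)).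
by case: eqP => [_|] /=; [apply: IHF | case: (dot f x) (dot f y) (head _ e) => [] [] []].
Qed.

(** The functional at [lead F (x + y)] is the first to take different values
    at [x] and [y], so a single bit of the shift decides their order. *)
Lemma before_lead F e x y : size x = size y -> has (dot^~ (addv x y)) F ->
  before F e x y =
  (dot (nth [::] F (lead F (addv x y))) x == nth false e (lead F (addv x y))).
Proof.
move=> xy; rewrite /lead; elim: F e => //= f F IHF e.
rewrite dot_addv // -negb_eqb; case: eqP => [_|_] /= sep; last by case: e.
by rewrite IHF //; case: e => [|? ?] //=; rewrite nth_nil.
Qed.

(** An orthogonal array of strength 2 and index [mu] on the first [n]
    columns. *)
Definition pairwise_uniform (n mu : nat) (E : seq (seq bool)) : Prop :=
  forall i j, i < n -> j < n -> i != j -> forall b c,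
  count (fun e => (nth false e i == b) && (nth false e j == c)) E = mu.

(** If the two leads coincide, one bit of the shift would have to equal both
    values of a functional that separates [x] from [y].  Otherwise two
    different bits are prescribed. *)
Lemma count_before2 F E mu x y z :
  size x = size y -> size z = size y ->
  has (dot^~ (addv x y)) F -> has (dot^~ (addv y z)) F ->
  pairwise_uniform (size F) mu E ->
  count (fun e => before F e x y && before F e y z) E =
  (lead F (addv x y) != lead F (addv y z)) * mu.
Proof.
move=> xy zy sep_xy sep_yz unifE.
under eq_count => e do rewrite !before_lead //.
set i := lead F _; set j := lead F _.
case: (eqVneq i j) => [eq_ij | ne_ij]; last first.
  rewrite mul1n -(unifE i j _ _ ne_ij (dot (nth [::] F i) x) (dot (nth [::] F j) y)).
  - by apply: eq_count => e; rewrite 2![_ == nth false e _]eq_sym.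
  - by rewrite -has_find.
  - by rewrite -has_find.
rewrite mul0n -eq_ij; apply/eqP; rewrite -[_ == 0]negbK -lt0n -has_count.
apply/hasPn => e _.
have: dot (nth [::] F i) (addv x y) by exact: (nth_find [::] sep_xy).
rewrite dot_addv // -negb_eqb; apply: contraNN.
by case/andP => /eqP-> /eqP->.
Qed.

(** * From orders to arrays *)

Lemma sum_count_mem (T : finType) (P : pred T) (s : seq T) :
  \sum_(x | P x) count_mem x s = count P s.
Proof.
elim: s => [|y s IHs] /=; first by rewrite big1.
rewrite big_split /= IHs; congr (_ + _); rewrite big_mkcond (bigD1 y) //= eqxx.
by rewrite big1 ?addn0 => [|x /negPf]; [case: (P y) | rewrite eq_sym => ->; case: (P x)].
Qed.

(** Place each symbol at the position that counts its predecessors. *)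
Lemma order_perm v (lt : rel 'I_v) :
  irreflexive lt -> transitive lt -> (forall a b, a != b -> lt a b || lt b a) ->
  exists p : 'S_v, forall s : seq 'I_v, covers p s = sorted lt s.
Proof.
move=> irr trans total.
pose S a := [set b | lt b a].
have S_lt a b : lt a b -> #|S a| < #|S b|.
  move=> ab; apply: proper_card; apply/properP; split.
    by apply/subsetP => c; rewrite !inE => /trans; apply.
  by exists a; rewrite !inE ?irr.
have S_v a : #|S a| < v.
  rewrite -[X in _ < X](card_ord v) -cardsT; apply: proper_card; apply/properP.
  by split; [apply: subsetT | exists a; rewrite !inE ?irr].
pose rank a := Ordinal (S_v a).
have rank_inj : injective rank.
  move=> a b /(congr1 val) /= ab; apply/eqP; apply: contraT => /total.
  by case/orP => /S_lt; rewrite ab ltnn.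
exists (perm rank_inj)^-1%g => s; rewrite /covers invgK; apply: eq_sorted => a b /=.
rewrite !permE /=; apply/idP/idP => [|/S_lt //]; apply: contraTT => nab.
rewrite -leqNgt; have [-> // | /total] := eqVneq a b.
by rewrite (negPf nab) => /S_lt/ltnW.
Qed.

Lemma PSCA_of_orders (K : eqType) v t lambda (lt : K -> rel 'I_v) (ks : seq K) :
  {in ks, forall k, [/\ irreflexive (lt k), transitive (lt k)
                      & forall a b, a != b -> lt k a b || lt k b a]} ->
  (forall s : t.-tuple 'I_v, uniq s -> count (fun k => sorted (lt k) s) ks = lambda) ->
  exists X : {mset 'S_v}, is_PSCA t lambda X.
Proof.
move=> orders counts.
(* Repeated permutations must be kept, hence a sequence rather than a set. *)
suff [ps psE] : exists ps : seq 'S_v, forall s : seq 'I_v,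
    count (fun p => covers p s) ps = count (fun k => sorted (lt k) s) ks.
  exists (seq_mset ps) => s s_uniq; rewrite -(counts s s_uniq) -psE -sum_count_mem.
  by apply: eq_bigr => p _; rewrite mset_seqE.
elim: ks orders {counts} => [|k ks IHks] orders; first by exists [::].
have [|ps psE] := IHks; first by move=> l l_ks; apply: orders; rewrite inE l_ks orbT.
have [|irr trans total] := orders k; first exact: mem_head.
have [p pE] := order_perm irr trans total.
by exists (p :: ps) => s /=; rewrite pE psE.
Qed.

(** [Fs] is a family of bases of the dual of F_2^n, and [m] of them have
    different leads at [u] and [w].  Since the same [m] serves the three pairs
    in the plane of [u] and [w], and each basis has equal leads at exactly one
    of these pairs, [m] is two thirds of the size of [Fs]. *)
Definition equilead (n m : nat) (Fs : seq (seq (seq bool))) : bool :=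
  let us := [seq u <- cube n | has id u] in
  all (fun F => (size F == n) && all (fun u => has (dot^~ u) F) us) Fs &&
  all (fun u => all (fun w => (u == w) ||
    (count (fun F => lead F u != lead F w) Fs == m)) us) us.

(** Each of the [m] bases that do not isolate the middle symbol contributes
    [mu] shifts, by [count_before2]. *)
Lemma PSCA3_of_flags n m mu Fs E v : v <= 2 ^ n ->
  equilead n m Fs -> pairwise_uniform n mu E ->
  exists X : {mset 'S_v}, is_PSCA 3 (m * mu) X.
Proof.
move=> v_n /andP[/allP bases /allP leads] unifE.
pose pt (a : 'I_v) := bits n a.
have size_pt a : size (pt a) = n by apply: size_bits.
have pt_inj a b : pt a = pt b -> a = b.
  by move/bits_inj => ab; apply/val_inj/ab; apply: leq_trans v_n.
have nz a b : a != b -> addv (pt a) (pt b) \in [seq u <- cube n | has id u].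
  move=> ab; rewrite mem_filter mem_cube size_addv ?size_pt // eqxx andbT.
  by rewrite has_addv ?size_pt //; apply: contraNneq ab => /pt_inj->.
have sep F a b : F \in Fs -> a != b -> has (dot^~ (addv (pt a) (pt b))) F.
  by case/bases/andP => _ /allP sepF /nz/sepF.
apply: (@PSCA_of_orders _ v 3 _ (fun k a b => before k.1 k.2 (pt a) (pt b))
          [seq (F, e) | F <- Fs, e <- E]).
  move=> _ /allpairsP[[F e] /= [F_Fs _ ->]] /=; split.
  - by move=> a; apply: before_irr.
  - by move=> b a c; apply: before_trans.
  - move=> a b /(sep _ _ _ F_Fs) sepF; apply: before_total.
    apply: sub_has sepF => f.
    by rewrite dot_addv ?size_pt // negb_eqb.
case=> [[|a [|b [|c [|]]]]] //= _; rewrite !inE negb_or !andbT => /andP[/andP[ab ac] bc].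
rewrite -sum1_count big_mkcond big_allpairs /=.
under eq_bigr => F _ do rewrite -big_mkcond sum1_count.
transitivity (\sum_(F <- Fs)
    (lead F (addv (pt a) (pt b)) != lead F (addv (pt b) (pt c))) * mu).
  apply: eq_big_seq => F F_Fs; have /andP[/eqP size_F _] := bases F F_Fs.
  under eq_count => e do rewrite andbT.
  by apply: count_before2; rewrite ?size_pt ?size_F ?(sep F).
rewrite -big_distrl /=; congr (_ * mu).
have /allP/(_ _ (nz _ _ bc)) := leads _ (nz _ _ ab).
case/orP => [/eqP/addv_inj | /eqP <-]; last first.
  by rewrite -sum1_count [RHS]big_mkcond; apply: eq_bigr => F _; case: (_ != _).
by rewrite !size_pt => /(_ erefl erefl)/pt_inj ac_eq; rewrite ac_eq eqxx in ac.
Qed.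

(** * The shifts and the two families of bases *)

(** The columns are the seven nonzero functionals on F_2^3.  Two different
    ones are linearly independent, so together they take each pair of values
    on two of the eight points. *)
Definition shifts : seq (seq bool) :=
  [seq [seq dot f s | f <- cube 3 & has id f] | s <- cube 3].

Lemma shifts_uniform n : n <= 7 -> pairwise_uniform n 2 shifts.
Proof.
move=> n7 i j i_n j_n ij b c; apply/eqP.
have check : all (fun i => all (fun j => (i == j) ||
    all (fun b => all (fun c =>
      count (fun e => (nth false e i == b) && (nth false e j == c)) shifts == 2)
    [:: false; true]) [:: false; true]) (iota 0 7)) (iota 0 7) by vm_compute.
have := allP (allP check i _) j; rewrite !mem_iota !(leq_trans _ n7) // (negPf ij).
by move=> /(_ isT isT)/allP/(_ b)/(_ _)/allP/(_ c); apply; case: (b) (c) => [] [].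
Qed.

(** The number [k] has to bound the length of a shortest word in [gs] for each
    element of the group that [gs] generates. *)
Definition orbits (k : nat) (gs : seq (seq bool -> seq bool)) :
    seq (seq (seq bool)) -> seq (seq (seq bool)) :=
  iter k (fun Fs => undup (Fs ++ [seq map g F | g <- gs, F <- Fs])).

(** A functional with coordinates a, b, c, d on F_2^4 is read as the element
    (a + b w) + (c + d w) t of the ring F_4[t]/(t^2), where w^2 = w + 1.  The
    maps [scale4], [shear4] and [wshear4] multiply by w, 1 + t and 1 + w t,
    which generate the group of units, of order 12. *)
Definition scale4 (x : seq bool) : seq bool :=
  if x is [:: a; b; c; d] then [:: b; a (+) b; d; c (+) d] else x.
Definition shear4 (x : seq bool) : seq bool :=
  if x is [:: a; b; c; d] then [:: a; b; a (+) c; b (+) d] else x.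
Definition wshear4 (x : seq bool) : seq bool :=
  if x is [:: a; b; c; d] then [:: a; b; b (+) c; a (+) b (+) d] else x.

(** The orbit of the basis 1, t, w t, w under the units: 12 bases. *)
Definition flags4 : seq (seq (seq bool)) :=
  orbits 4 [:: scale4; shear4; wshear4] [:: map (bits 4) [:: 1; 4; 8; 2]].

Lemma equilead_flags4 : equilead 4 8 flags4.
Proof. by vm_compute. Qed.

(** A functional on F_2^5 is read as an element (a + b w, c + d w, e) of
    F_4 x F_4 x F_2.  Multiplying the first coordinate by w and exchanging the
    first two coordinates generate a wreath product of order 18. *)
Definition scale5 (x : seq bool) : seq bool :=
  if x is [:: a; b; c; d; e] then [:: b; a (+) b; c; d; e] else x.
Definition swap5 (x : seq bool) : seq bool :=
  if x is [:: a; b; c; d; e] then [:: c; d; a; b; e] else x.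

(** Four orbits of 18 bases each; the four representatives were found by an
    exhaustive search among the orbits of flags. *)
Definition flags5 : seq (seq (seq bool)) :=
  orbits 6 [:: scale5; swap5]
    [seq map (bits 5) F | F <- [:: [:: 1; 4; 16; 10; 2]; [:: 5; 27; 16; 1; 2];
                                   [:: 17; 5; 1; 10; 2]; [:: 21; 11; 16; 1; 2]]].

Lemma equilead_flags5 : equilead 5 48 flags5.
Proof. by vm_compute. Qed.

(** * The bounds *)

Lemma leq_g v t lambda (X : {mset 'S_v}) :
  0 < lambda -> is_PSCA t lambda X -> g v t <= lambda.
Proof.
move=> lambda_gt0 PSCA_X; rewrite /g; case: ex_minnP => m _; apply.
by rewrite /PSCA_lambda lambda_gt0; apply/asboolP; exists X.
Qed.

Theorem theorem4p6 :
  (forall v : nat, 3 <= v <= 16 -> g v 3 <= 16) /\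
  (forall v : nat, 3 <= v <= 32 -> g v 3 <= 96).
Proof.
split=> v /andP[_ v_le].
- have [X] := PSCA3_of_flags (n := 4) v_le equilead_flags4 (shifts_uniform (n := 4) isT).
  exact: leq_g.
- have [X] := PSCA3_of_flags (n := 5) v_le equilead_flags5 (shifts_uniform (n := 5) isT).
  exact: leq_g.
Qed.
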